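(* Consider a functional PTS specification, its EPTS and its Dedukti encoding. Suppose $\Gamma\vdash A\ type$ and let $M$ be a Dedukti term in $\beta$-normal form with $[\![\Gamma]\!]\vdash_{DK}M:T$, where either $\Gamma\vdash A:s_A$ and $T=\mathbf{El}_{s_A}[\![A]\!]$, or $A$ is a sort and $T=\mathbf U_A$. Then $M$ is an invertible form, $\Gamma\vdash\lfloor M\rfloor:A$, and $[\![\lfloor M\rfloor]\!]\equiv_H M$.
   Context: Functional PTS specification $(\mathcal S,\mathcal A,\mathcal R)$ ($\mathcal A$ functional, $\mathcal R$ functional in first two components); top-sort: no $(s,s')\in\mathcal A$. EPTS terms $x\mid s\mid\Pi_{s_1,s_2}(A,x.B)\mid\lambda_{s_1,s_2}(A,x.B,x.M)\mid@_{s_1,s_2}(A,x.B,M,N)$; reduction: context closure of $@_{s_1,s_2}(A,x.B,\lambda_{s_1,s_2}(A',x.B',x.M),N)\hookrightarrow M\{N/x\}$; typing: Empty, Decl, Conv (modulo $\equiv$), Var, Sort ($(s_1,s_2)\in\mathcal A$ gives $s_1:s_2$), and for $(s_1,s_2,s_3)\in\mathcal R$: Prod ($A:s_1$, $x:A\vdash B:s_2$ give $\Pi_{s_1,s_2}(A,x.B):s_3$), Abs (plus $x:A\vdash M:B$ gives $\lambda_{s_1,s_2}(A,x.B,x.M):\Pi_{s_1,s_2}(A,x.B)$), App ($A:s_1$, $x:A\vdash B:s_2$, $N:A$, $M:\Pi_{s_1,s_2}(A,x.B)$ give $@_{s_1,s_2}(A,x.B,M,N):B\{N/x\}$). $\Gamma\vdash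 A\ type$: $\Gamma\vdash A:s$ for some $s$, or $A$ a top-sort with $\Gamma$ well-formed. Dedukti theory $(\Sigma_{EPTS},\mathscr R_{EPTS})$: $\mathbf U_s:\mathtt{TYPE}$, $\mathbf{El}_s[A:\mathbf U_s]:\mathtt{TYPE}$; $\mathbf u_{s_1}:\mathbf U_{s_2}$ with rule $\mathbf{El}_{s_2}\mathbf u_{s_1}\hookrightarrow\mathbf U_{s_1}$ for $(s_1,s_2)\in\mathcal A$; for $(s_1,s_2,s_3)\in\mathcal R$: $\mathbf{Prod}_{s_1,s_2}[A:\mathbf U_{s_1};B:\mathbf{El}_{s_1}A\to\mathbf U_{s_2}]:\mathbf U_{s_3}$, $\mathbf{abs}_{s_1,s_2}[A;B;M:\Pi x:\mathbf{El}_{s_1}A.\mathbf{El}_{s_2}(Bx)]:\mathbf{El}_{s_3}(\mathbf{Prod}_{s_1,s_2}AB)$, $\mathbf{app}_{s_1,s_2}[A;B;M:\mathbf{El}_{s_3}(\mathbf{Prod}_{s_1,s_2}AB);N:\mathbf{El}_{s_1}A]:\mathbf{El}_{s_2}(BN)$, rule $\mathbf{app}_{s_1,s_2}AB(\mathbf{abs}_{s_1,s_2}A'B'M)N\hookrightarrow MN$; $\vdash_{DK}$ is Dedukti ($\lambda\Pi$ with constants, conversion modulo $\beta$ and rules) typing. Translation $[\![-]\!]$: $x\mapsto x$, $s\mapsto\mathbf u_s$, $\Pi_{s_1,s_2}(A,x.B)\mapsto\mathbf{Prod}_{s_1,s_2}[\![A]\!](\lambda x:\mathbf{El}_{s_1}[\![A]\!].[\![B]\!])$,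 $\lambda_{s_1,s_2}(A,x.B,x.M)\mapsto\mathbf{abs}_{s_1,s_2}[\![A]\!](\lambda x:\mathbf{El}_{s_1}[\![A]\!].[\![B]\!])(\lambda x:\mathbf{El}_{s_1}[\![A]\!].[\![M]\!])$, $@_{s_1,s_2}(A,x.B,M,N)\mapsto\mathbf{app}_{s_1,s_2}[\![A]\!](\lambda x:\mathbf{El}_{s_1}[\![A]\!].[\![B]\!])[\![M]\!][\![N]\!]$; $[\![\Gamma,x:A]\!]=[\![\Gamma]\!],x:\mathbf{El}_{s_A}[\![A]\!]$. Invertible forms: $M::=x\mid\mathbf u_s\mid\mathbf{abs}_{s_1,s_2}A(\lambda x:T_1.B)(\lambda x:T_2.M)\mid(\lambda x:T.M)N\mid\mathbf{Prod}_{s_1,s_2}A(\lambda x:T_1.B)\mid\mathbf{app}_{s_1,s_2}A(\lambda x:T_1.B)MN$ ($T$'s arbitrary). Inverse translation: $\lfloor x\rfloor=x$, $\lfloor\mathbf u_s\rfloor=s$, $\lfloor(\lambda x:T.M)N\rfloor=\lfloor M\rfloor\{\lfloor N\rfloor/x\}$, $\lfloor\mathbf{Prod}_{s_1,s_2}A(\lambda x:T.B)\rfloor=\Pi_{s_1,s_2}(\lfloor A\rfloor,x.\lfloor B\rfloor)$, $\lfloor\mathbf{abs}_{s_1,s_2}A(\lambda x:T.B)(\lambda x:T'.M)\rfloor=\lambda_{s_1,s_2}(\lfloor A\rfloor,x.\lfloor B\rfloor,x.\lfloor M\rfloor)$, $\lfloor\mathbf{app}_{s_1,s_2}A(\lambda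 x:T.B)MN\rfloor=@_{s_1,s_2}(\lfloor A\rfloor,x.\lfloor B\rfloor,\lfloor M\rfloor,\lfloor N\rfloor)$. $\equiv_H$: equivalence generated by steps $C(\lambda x:A.P)\hookrightarrow C(\lambda x:A'.P)$ with $A\hookrightarrow_{\beta\mathscr R_{EPTS}}A'$ and $C$ a context. *)

(* Defs.v *)
From Stdlib Require Import List Relations.
Import ListNotations.

Set Implicit Arguments.
Unset Strict Implicit.

(** * PTS specifications *)

Record pts_spec : Type := PtsSpec {
  sort : Type;
  ax : sort -> sort -> Prop;
  rl : sort -> sort -> sort -> Prop
}.

Definition functional (P : pts_spec) : Prop :=
  (forall s1 s2 s2' : sort P, ax s1 s2 -> ax s1 s2' -> s2 = s2') /\
  (forall s1 s2 s3 s3' : sort P, rl s1 s2 s3 -> rl s1 s2 s3' -> s3 = s3').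

Definition top_sort (P : pts_spec) (s : sort P) : Prop :=
  ~ exists s', ax s s'.

(** * EPTS

   De Bruijn indices. In [EPi s1 s2 A B], [ELam s1 s2 A B M] and
   [EApp s1 s2 A B M N] one variable is bound in [B], and, for [ELam] only,
   one variable in [M]. Contexts are lists whose head is the most recent
   declaration. *)

Inductive eterm (S : Type) : Type :=
| EVar (n : nat)
| ESort (s : S)
| EPi (s1 s2 : S) (A B : eterm S)
| ELam (s1 s2 : S) (A B M : eterm S)
| EApp (s1 s2 : S) (A B M N : eterm S).

Arguments EVar {S} n.

Definition upren (r : nat -> nat) (n : nat) : nat :=
  match n with 0 => 0 | S m => S (r m) end.

Fixpoint eren (S : Type) (r : nat -> nat) (t : eterm S) : eterm S :=
  match t with
  | EVar n => EVar (r n)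
  | ESort s => ESort s
  | EPi s1 s2 A B => EPi s1 s2 (eren r A) (eren (upren r) B)
  | ELam s1 s2 A B M =>
      ELam s1 s2 (eren r A) (eren (upren r) B) (eren (upren r) M)
  | EApp s1 s2 A B M N =>
      EApp s1 s2 (eren r A) (eren (upren r) B) (eren r M) (eren r N)
  end.

Definition eup (S : Type) (f : nat -> eterm S) (n : nat) : eterm S :=
  match n with 0 => EVar 0 | Datatypes.S m => eren Datatypes.S (f m) end.

Fixpoint esubst (S : Type) (f : nat -> eterm S) (t : eterm S) : eterm S :=
  match t with
  | EVar n => f n
  | ESort s => ESort s
  | EPi s1 s2 A B => EPi s1 s2 (esubst f A) (esubst (eup f) B)
  | ELam s1 s2 A B M =>
      ELam s1 s2 (esubst f A) (esubst (eup f) B) (esubst (eup f) M)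
  | EApp s1 s2 A B M N =>
      EApp s1 s2 (esubst f A) (esubst (eup f) B) (esubst f M) (esubst f N)
  end.

(** [esubst1 N M] is [M{N/x}] where [x] is the variable of index 0. *)
Definition esubst1 (S : Type) (N M : eterm S) : eterm S :=
  esubst (fun n => match n with 0 => N | Datatypes.S m => EVar m end) M.

Inductive ered (S : Type) : eterm S -> eterm S -> Prop :=
| ered_beta s1 s2 A B A' B' M N :
    ered (EApp s1 s2 A B (ELam s1 s2 A' B' M) N) (esubst1 N M)
| ered_Pi_dom s1 s2 A A' B : ered A A' -> ered (EPi s1 s2 A B) (EPi s1 s2 A' B)
| ered_Pi_cod s1 s2 A B B' : ered B B' -> ered (EPi s1 s2 A B) (EPi s1 s2 A B')
| ered_Lam_dom s1 s2 A A' B M :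
    ered A A' -> ered (ELam s1 s2 A B M) (ELam s1 s2 A' B M)
| ered_Lam_cod s1 s2 A B B' M :
    ered B B' -> ered (ELam s1 s2 A B M) (ELam s1 s2 A B' M)
| ered_Lam_body s1 s2 A B M M' :
    ered M M' -> ered (ELam s1 s2 A B M) (ELam s1 s2 A B M')
| ered_App_dom s1 s2 A A' B M N :
    ered A A' -> ered (EApp s1 s2 A B M N) (EApp s1 s2 A' B M N)
| ered_App_cod s1 s2 A B B' M N :
    ered B B' -> ered (EApp s1 s2 A B M N) (EApp s1 s2 A B' M N)
| ered_App_fun s1 s2 A B M M' N :
    ered M M' -> ered (EApp s1 s2 A B M N) (EApp s1 s2 A B M' N)
| ered_App_arg s1 s2 A B M N N' :
    ered N N' -> ered (EApp s1 s2 A B M N) (EApp s1 s2 A B M N').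

Definition econv (S : Type) : eterm S -> eterm S -> Prop :=
  clos_refl_sym_trans _ (@ered S).

Definition ectx (S : Type) : Type := list (eterm S).

Inductive ewf (P : pts_spec) : ectx (sort P) -> Prop :=
| ewf_empty : ewf []
| ewf_decl G A s : ety G A (ESort s) -> ewf (A :: G)
with ety (P : pts_spec) :
    ectx (sort P) -> eterm (sort P) -> eterm (sort P) -> Prop :=
| ety_conv G M A B s :
    ety G M A -> ety G B (ESort s) -> econv A B -> ety G M B
| ety_var G n A :
    ewf G -> nth_error G n = Some A ->
    ety G (EVar n) (eren (fun i => i + S n) A)
| ety_sort G s1 s2 : ewf G -> ax s1 s2 -> ety G (ESort s1) (ESort s2)
| ety_prod G s1 s2 s3 A B :
    rl s1 s2 s3 -> ety G A (ESort s1) -> ety (A :: G) B (ESort s2) ->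
    ety G (EPi s1 s2 A B) (ESort s3)
| ety_abs G s1 s2 s3 A B M :
    rl s1 s2 s3 -> ety G A (ESort s1) -> ety (A :: G) B (ESort s2) ->
    ety (A :: G) M B ->
    ety G (ELam s1 s2 A B M) (EPi s1 s2 A B)
| ety_app G s1 s2 s3 A B M N :
    rl s1 s2 s3 -> ety G A (ESort s1) -> ety (A :: G) B (ESort s2) ->
    ety G N A -> ety G M (EPi s1 s2 A B) ->
    ety G (EApp s1 s2 A B M N) (esubst1 N B).

Definition etype (P : pts_spec) (G : ectx (sort P)) (A : eterm (sort P)) : Prop :=
  (exists s, ety G A (ESort s)) \/
  (exists s, A = ESort s /\ top_sort s /\ ewf G).

(** * Dedukti

   [DCon c [M1; ...; Mn]] is the application of the constant [c] to its full
   list of arguments, as opposed to the framework application [DApp]. *)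

Inductive dsort : Type := TYPE | KIND.

Inductive dterm (C : Type) : Type :=
| DVar (n : nat)
| DCon (c : C) (args : list (dterm C))
| DSort (s : dsort)
| DPi (A B : dterm C)
| DLam (A M : dterm C)
| DApp (M N : dterm C).

Arguments DVar {C} n.
Arguments DSort {C} s.

Fixpoint dren (C : Type) (r : nat -> nat) (t : dterm C) : dterm C :=
  match t with
  | DVar n => DVar (r n)
  | DCon c args => DCon c (map (dren r) args)
  | DSort s => DSort s
  | DPi A B => DPi (dren r A) (dren (upren r) B)
  | DLam A M => DLam (dren r A) (dren (upren r) M)
  | DApp M N => DApp (dren r M) (dren r N)
  end.

Definition dup (C : Type) (f : nat -> dterm C) (n : nat) : dterm C :=
  match n with 0 => DVar 0 | S m => dren S (f m) end.

Fixpoint dsubst (C : Type) (f : nat -> dterm C) (t : dterm C) : dterm C :=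
  match t with
  | DVar n => f n
  | DCon c args => DCon c (map (dsubst f) args)
  | DSort s => DSort s
  | DPi A B => DPi (dsubst f A) (dsubst (dup f) B)
  | DLam A M => DLam (dsubst f A) (dsubst (dup f) M)
  | DApp M N => DApp (dsubst f M) (dsubst f N)
  end.

Definition dsubst1 (C : Type) (N M : dterm C) : dterm C :=
  dsubst (fun n => match n with 0 => N | S m => DVar m end) M.

(** Simultaneous instantiation of the variables of a context [x1, ..., xn] by
   [args = [M1; ...; Mn]]; the most recent variable [xn] has index 0. *)
Definition dinst (C : Type) (args : list (dterm C)) (t : dterm C) : dterm C :=
  dsubst (fun n => nth n (rev args) (DVar (n - length args))) t.

Inductive dctxclos (C : Type) (R : dterm C -> dterm C -> Prop) :
    dterm C -> dterm C -> Prop :=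
| dcc_root t t' : R t t' -> dctxclos R t t'
| dcc_con c l1 t t' l2 :
    dctxclos R t t' ->
    dctxclos R (DCon c (l1 ++ t :: l2)) (DCon c (l1 ++ t' :: l2))
| dcc_Pi_dom A A' B : dctxclos R A A' -> dctxclos R (DPi A B) (DPi A' B)
| dcc_Pi_cod A B B' : dctxclos R B B' -> dctxclos R (DPi A B) (DPi A B')
| dcc_Lam_dom A A' M : dctxclos R A A' -> dctxclos R (DLam A M) (DLam A' M)
| dcc_Lam_body A M M' : dctxclos R M M' -> dctxclos R (DLam A M) (DLam A M')
| dcc_App_fun M M' N : dctxclos R M M' -> dctxclos R (DApp M N) (DApp M' N)
| dcc_App_arg M N N' : dctxclos R N N' -> dctxclos R (DApp M N) (DApp M N').

(** A theory: [dsig c D A] is the declaration [c[D] : A], and [drule l r] the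
   rewrite rule [l --> r], whose free variables are its pattern variables. *)
Record dtheory (C : Type) : Type := DTheory {
  dsig : C -> list (dterm C) -> dterm C -> Prop;
  drule : dterm C -> dterm C -> Prop
}.

Inductive dbeta_root (C : Type) : dterm C -> dterm C -> Prop :=
| dbeta_root_intro A M N : dbeta_root (DApp (DLam A M) N) (dsubst1 N M).

Inductive drule_root (C : Type) (Th : dtheory C) : dterm C -> dterm C -> Prop :=
| drule_root_intro l r f :
    drule Th l r -> drule_root Th (dsubst f l) (dsubst f r).

Definition dbeta (C : Type) : dterm C -> dterm C -> Prop :=
  dctxclos (@dbeta_root C).

Definition dred (C : Type) (Th : dtheory C) : dterm C -> dterm C -> Prop :=
  dctxclos (union _ (@dbeta_root C) (drule_root Th)).

Definition dconv (C : Type) (Th : dtheory C) : dterm C -> dterm C -> Prop :=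
  clos_refl_sym_trans _ (dred Th).

Definition beta_normal (C : Type) (M : dterm C) : Prop :=
  ~ exists M', dbeta M M'.

Definition dctx (C : Type) : Type := list (dterm C).

Inductive dwf (C : Type) (Th : dtheory C) : dctx C -> Prop :=
| dwf_empty : dwf Th []
| dwf_decl G A : dty Th G A (DSort TYPE) -> dwf Th (A :: G)
with dty (C : Type) (Th : dtheory C) :
    dctx C -> dterm C -> dterm C -> Prop :=
| dty_conv G M A B s :
    dty Th G M A -> dty Th G B (DSort s) -> dconv Th A B -> dty Th G M B
| dty_var G n A :
    dwf Th G -> nth_error G n = Some A ->
    dty Th G (DVar n) (dren (fun i => i + S n) A)
| dty_sort G : dwf Th G -> dty Th G (DSort TYPE) (DSort KIND)
| dty_con G c D A s args :
    dsig Th c D A -> dty Th D A (DSort s) -> dargs Th G args D ->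
    dty Th G (DCon c args) (dinst args A)
| dty_pi G A B s :
    dty Th G A (DSort TYPE) -> dty Th (A :: G) B (DSort s) ->
    dty Th G (DPi A B) (DSort s)
| dty_lam G A B M s :
    dty Th G A (DSort TYPE) -> dty Th (A :: G) B (DSort s) ->
    dty Th (A :: G) M B ->
    dty Th G (DLam A M) (DPi A B)
| dty_app G A B M N :
    dty Th G M (DPi A B) -> dty Th G N A ->
    dty Th G (DApp M N) (dsubst1 N B)
with dargs (C : Type) (Th : dtheory C) :
    dctx C -> list (dterm C) -> dctx C -> Prop :=
| dargs_nil G : dwf Th G -> dargs Th G [] []
| dargs_snoc G args D N A :
    dargs Th G args D -> dty Th G N (dinst args A) ->
    dargs Th G (args ++ [N]) (A :: D).

(** * The Dedukti encoding of EPTS *)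

Inductive econst (S : Type) : Type :=
| cU (s : S)
| cEl (s : S)
| cu (s : S)
| cProd (s1 s2 : S)
| cabs (s1 s2 : S)
| capp (s1 s2 : S).

Definition DU (S : Type) (s : S) : dterm (econst S) := DCon (cU s) [].
Definition DEl (S : Type) (s : S) (A : dterm (econst S)) : dterm (econst S) :=
  DCon (cEl s) [A].
Definition Du (S : Type) (s : S) : dterm (econst S) := DCon (cu s) [].
Definition DProd (S : Type) (s1 s2 : S) (A B : dterm (econst S)) :
    dterm (econst S) := DCon (cProd s1 s2) [A; B].
Definition Dabs (S : Type) (s1 s2 : S) (A B M : dterm (econst S)) :
    dterm (econst S) := DCon (cabs s1 s2) [A; B; M].
Definition Dapp (S : Type) (s1 s2 : S) (A B M N : dterm (econst S)) :
    dterm (econst S) := DCon (capp s1 s2) [A; B; M; N].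

Inductive sig_EPTS (P : pts_spec) :
    econst (sort P) -> dctx (econst (sort P)) -> dterm (econst (sort P)) -> Prop :=
| sig_U s : sig_EPTS (cU s) [] (DSort TYPE)
| sig_El s : sig_EPTS (cEl s) [DU s] (DSort TYPE)
| sig_u s1 s2 : ax s1 s2 -> sig_EPTS (cu s1) [] (DU s2)
| sig_Prod s1 s2 s3 : rl s1 s2 s3 ->
    sig_EPTS (cProd s1 s2)
      [ DPi (DEl s1 (DVar 0)) (DU s2);                              (* B *)
        DU s1 ]                                                     (* A *)
      (DU s3)
| sig_abs s1 s2 s3 : rl s1 s2 s3 ->
    sig_EPTS (cabs s1 s2)
      [ DPi (DEl s1 (DVar 1)) (DEl s2 (DApp (DVar 1) (DVar 0)));    (* M *)
        DPi (DEl s1 (DVar 0)) (DU s2);                              (* B *)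
        DU s1 ]                                                     (* A *)
      (DEl s3 (DProd s1 s2 (DVar 2) (DVar 1)))
| sig_app s1 s2 s3 : rl s1 s2 s3 ->
    sig_EPTS (capp s1 s2)
      [ DEl s1 (DVar 2);                                            (* N *)
        DEl s3 (DProd s1 s2 (DVar 1) (DVar 0));                     (* M *)
        DPi (DEl s1 (DVar 0)) (DU s2);                              (* B *)
        DU s1 ]                                                     (* A *)
      (DEl s2 (DApp (DVar 2) (DVar 0))).

Inductive rule_EPTS (P : pts_spec) :
    dterm (econst (sort P)) -> dterm (econst (sort P)) -> Prop :=
| rule_El s1 s2 : ax s1 s2 -> rule_EPTS (DEl s2 (Du s1)) (DU s1)
| rule_app s1 s2 s3 : rl s1 s2 s3 ->
    rule_EPTS
      (Dapp s1 s2 (DVar 0) (DVar 1)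
         (Dabs s1 s2 (DVar 2) (DVar 3) (DVar 4)) (DVar 5))
      (DApp (DVar 4) (DVar 5)).

Definition EPTS (P : pts_spec) : dtheory (econst (sort P)) :=
  DTheory (@sig_EPTS P) (@rule_EPTS P).

Fixpoint tr (S : Type) (t : eterm S) : dterm (econst S) :=
  match t with
  | EVar n => DVar n
  | ESort s => Du s
  | EPi s1 s2 A B => DProd s1 s2 (tr A) (DLam (DEl s1 (tr A)) (tr B))
  | ELam s1 s2 A B M =>
      Dabs s1 s2 (tr A) (DLam (DEl s1 (tr A)) (tr B)) (DLam (DEl s1 (tr A)) (tr M))
  | EApp s1 s2 A B M N =>
      Dapp s1 s2 (tr A) (DLam (DEl s1 (tr A)) (tr B)) (tr M) (tr N)
  end.

(** The graph of the translation of contexts: the sort [s_A] is the one such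
   that [G |- A : s_A], which is unique for a functional specification. *)
Inductive trctx (P : pts_spec) :
    ectx (sort P) -> dctx (econst (sort P)) -> Prop :=
| trctx_empty : trctx [] []
| trctx_decl G D A sA :
    trctx G D -> ety G A (ESort sA) -> trctx (A :: G) (DEl sA (tr A) :: D).

Inductive invertible (S : Type) : dterm (econst S) -> Prop :=
| invertible_var n : invertible (DVar n)
| invertible_u s : invertible (Du s)
| invertible_abs s1 s2 A T1 B T2 M :
    invertible A -> invertible B -> invertible M ->
    invertible (Dabs s1 s2 A (DLam T1 B) (DLam T2 M))
| invertible_beta T M N :
    invertible M -> invertible N -> invertible (DApp (DLam T M) N)
| invertible_Prod s1 s2 A T1 B :
    invertible A -> invertible B -> invertible (DProd s1 s2 A (DLam T1 B))
| invertible_app s1 s2 A T1 B M N :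
    invertible A -> invertible B -> invertible M -> invertible N ->
    invertible (Dapp s1 s2 A (DLam T1 B) M N).

(** Only meaningful on invertible forms; [EVar 0] is a junk value. *)
Fixpoint inv (S : Type) (t : dterm (econst S)) : eterm S :=
  match t with
  | DVar n => EVar n
  | DCon (cu s) [] => ESort s
  | DCon (cProd s1 s2) [A; DLam _ B] => EPi s1 s2 (inv A) (inv B)
  | DCon (cabs s1 s2) [A; DLam _ B; DLam _ M] =>
      ELam s1 s2 (inv A) (inv B) (inv M)
  | DCon (capp s1 s2) [A; DLam _ B; M; N] =>
      EApp s1 s2 (inv A) (inv B) (inv M) (inv N)
  | DApp (DLam _ M) N => esubst1 (inv N) (inv M)
  | _ => EVar 0
  end.

Inductive H_root (P : pts_spec) :
    dterm (econst (sort P)) -> dterm (econst (sort P)) -> Prop :=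
| H_root_intro A A' M :
    dred (EPTS P) A A' -> H_root (DLam A M) (DLam A' M).

Definition Hconv (P : pts_spec) :
    dterm (econst (sort P)) -> dterm (econst (sort P)) -> Prop :=
  clos_refl_sym_trans _ (dctxclos (@H_root P)).

(* Main.v *)
(** Call a Dedukti context [D] a translation of [G] up to conversion if its
    entries are convertible to [El_s [[A]]], and similarly for the type of [M].
    Working up to conversion makes the induction on [M] go through with only
    generation for Dedukti typing: neither soundness of the encoding nor
    subject reduction is needed.  No variable or constant has a type convertible
    to a product, so the functional arguments of [M] are abstractions and no
    framework application occurs.  Types are compared using
    confluence of [beta + R], and conversions are pulled back to EPTS because
    invertible forms are stable by reduction and [inv] maps reductions to
    conversions. *)

From Stdlib Require Import List Relations Lia.
Import ListNotations.
Require Import Defs.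

Set Implicit Arguments.
Unset Strict Implicit.

(** * Substitution calculus *)

Lemma eren_ext K (t : eterm K) : forall r r',
  (forall n, r n = r' n) -> eren r t = eren r' t.
Proof.
  induction t; intros r r' H; cbn; f_equal; auto;
    match goal with IH : _ |- _ => apply IH end;
    intros [|m]; cbn; auto.
Qed.

Lemma esubst_ext K (t : eterm K) : forall f f',
  (forall n, f n = f' n) -> esubst f t = esubst f' t.
Proof.
  induction t; intros f f' H; cbn; f_equal; auto;
    match goal with IH : _ |- _ => apply IH end;
    intros [|m]; cbn; auto; now rewrite H.
Qed.

Lemma eren_eren K (t : eterm K) : forall r r',
  eren r (eren r' t) = eren (fun n => r (r' n)) t.
Proof.
  induction t; intros r r'; cbn; f_equal; auto;
    match goal with IH : _ |- _ => rewrite IH end;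
    apply eren_ext; intros [|m]; reflexivity.
Qed.

Lemma esubst_eren K (t : eterm K) : forall f r,
  esubst f (eren r t) = esubst (fun n => f (r n)) t.
Proof.
  induction t; intros f r; cbn; f_equal; auto;
    match goal with IH : _ |- _ => rewrite IH end;
    apply esubst_ext; intros [|m]; reflexivity.
Qed.

Lemma eren_esubst K (t : eterm K) : forall r f,
  eren r (esubst f t) = esubst (fun n => eren r (f n)) t.
Proof.
  induction t; intros r f; cbn; f_equal; auto;
    match goal with IH : _ |- _ => rewrite IH end;
    apply esubst_ext; intros [|m]; cbn; auto;
    now rewrite !eren_eren.
Qed.

Lemma esubst_esubst K (t : eterm K) : forall f g,
  esubst f (esubst g t) = esubst (fun n => esubst f (g n)) t.
Proof.
  induction t; intros f g; cbn; f_equal; auto;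
    match goal with IH : _ |- _ => rewrite IH end;
    apply esubst_ext; intros [|m]; cbn; auto;
    now rewrite esubst_eren, eren_esubst.
Qed.

Lemma esubst_var K (t : eterm K) : forall f,
  (forall n, f n = EVar n) -> esubst f t = t.
Proof.
  induction t; intros f H; cbn; f_equal; auto;
    match goal with IH : _ |- _ => apply IH end;
    intros [|m]; cbn; auto; now rewrite H.
Qed.

Lemma esubst_esubst1 K f (N M : eterm K) :
  esubst f (esubst1 N M) = esubst1 (esubst f N) (esubst (eup f) M).
Proof.
  unfold esubst1. rewrite !esubst_esubst. apply esubst_ext.
  intros [|m]; cbn; auto. rewrite esubst_eren. symmetry. now apply esubst_var.
Qed.

Lemma eren_esubst1 K r (N M : eterm K) :
  eren r (esubst1 N M) = esubst1 (eren r N) (eren (upren r) M).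
Proof.
  unfold esubst1. rewrite eren_esubst, esubst_eren. apply esubst_ext.
  now intros [|m].
Qed.

(** * Substitution on Dedukti terms *)

Lemma dterm_ind_list C (Q : dterm C -> Prop) :
  (forall n, Q (DVar n)) ->
  (forall c l, Forall Q l -> Q (DCon c l)) ->
  (forall s, Q (DSort s)) ->
  (forall A B, Q A -> Q B -> Q (DPi A B)) ->
  (forall A M, Q A -> Q M -> Q (DLam A M)) ->
  (forall M N, Q M -> Q N -> Q (DApp M N)) ->
  forall t, Q t.
Proof.
  intros HVar HCon HSort HPi HLam HApp.
  fix IH 1. intros [n|c l|s|A B|A M|M N].
  - apply HVar.
  - apply HCon. induction l; constructor; [apply IH | assumption].
  - apply HSort.
  - apply HPi; apply IH.
  - apply HLam; apply IH.
  - apply HApp; apply IH.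
Qed.

Ltac solve_map :=
  rewrite ?map_map; apply map_ext_Forall;
  match goal with H : Forall _ _ |- _ =>
    eapply Forall_impl; [| exact H]; cbn; auto end.

Lemma dren_ext C (t : dterm C) : forall r r',
  (forall n, r n = r' n) -> dren r t = dren r' t.
Proof.
  induction t using dterm_ind_list; intros r r' E; cbn; f_equal; auto;
    try solve_map;
    match goal with IH : _ |- _ => apply IH end;
    intros [|m]; cbn; auto.
Qed.

Lemma dsubst_ext C (t : dterm C) : forall f f',
  (forall n, f n = f' n) -> dsubst f t = dsubst f' t.
Proof.
  induction t using dterm_ind_list; intros f f' E; cbn; f_equal; auto;
    try solve_map;
    match goal with IH : _ |- _ => apply IH end;
    intros [|m]; cbn; auto; now rewrite E.
Qed.

Lemma dren_dren C (t : dterm C) : forall r r',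
  dren r (dren r' t) = dren (fun n => r (r' n)) t.
Proof.
  induction t using dterm_ind_list; intros r r'; cbn; f_equal; auto;
    try solve_map;
    match goal with IH : _ |- _ => rewrite IH end;
    apply dren_ext; intros [|m]; reflexivity.
Qed.

Lemma dsubst_dren C (t : dterm C) : forall f r,
  dsubst f (dren r t) = dsubst (fun n => f (r n)) t.
Proof.
  induction t using dterm_ind_list; intros f r; cbn; f_equal; auto;
    try solve_map;
    match goal with IH : _ |- _ => rewrite IH end;
    apply dsubst_ext; intros [|m]; reflexivity.
Qed.

Lemma dren_dsubst C (t : dterm C) : forall r f,
  dren r (dsubst f t) = dsubst (fun n => dren r (f n)) t.
Proof.
  induction t using dterm_ind_list; intros r f; cbn; f_equal; auto;
    try solve_map;
    match goal with IH : _ |- _ => rewrite IH end;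
    apply dsubst_ext; intros [|m]; cbn; auto;
    now rewrite !dren_dren.
Qed.

Lemma dsubst_dsubst C (t : dterm C) : forall f g,
  dsubst f (dsubst g t) = dsubst (fun n => dsubst f (g n)) t.
Proof.
  induction t using dterm_ind_list; intros f g; cbn; f_equal; auto;
    try solve_map;
    match goal with IH : _ |- _ => rewrite IH end;
    apply dsubst_ext; intros [|m]; cbn; auto;
    now rewrite dsubst_dren, dren_dsubst.
Qed.

Lemma dsubst_var C (t : dterm C) : forall f,
  (forall n, f n = DVar n) -> dsubst f t = t.
Proof.
  induction t using dterm_ind_list; intros f E; cbn; f_equal; auto.
  - rewrite <- (map_id l) at 2. solve_map.
  - apply IHt2. intros [|m]; cbn; auto; now rewrite E.
  - apply IHt2. intros [|m]; cbn; auto; now rewrite E.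
Qed.

Lemma dsubst_dsubst1 C f (N M : dterm C) :
  dsubst f (dsubst1 N M) = dsubst1 (dsubst f N) (dsubst (dup f) M).
Proof.
  unfold dsubst1. rewrite !dsubst_dsubst. apply dsubst_ext.
  intros [|m]; cbn; auto. rewrite dsubst_dren. symmetry. now apply dsubst_var.
Qed.

Lemma dren_dsubst1 C r (N M : dterm C) :
  dren r (dsubst1 N M) = dsubst1 (dren r N) (dren (upren r) M).
Proof.
  unfold dsubst1. rewrite dren_dsubst, dsubst_dren. apply dsubst_ext.
  now intros [|m].
Qed.

(** The last argument of [abs] has a type containing [B x] with [B] weakened. When [B] is an
    abstraction, this identity says that contracting [B x] gives back its body. *)
Lemma dsubst1_var0_shift C (M : dterm C) :
  dsubst1 (DVar 0) (dren (upren S) M) = M.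
Proof.
  unfold dsubst1. rewrite dsubst_dren. apply dsubst_var. now intros [|m].
Qed.

(** * The translation and its left inverse *)

Lemma tr_eren K (t : eterm K) : forall r, tr (eren r t) = dren r (tr t).
Proof.
  induction t; intros r; cbn;
    repeat match goal with IH : forall r, tr _ = _ |- _ => rewrite IH; clear IH end;
    reflexivity.
Qed.

Lemma tr_esubst K (t : eterm K) : forall f,
  tr (esubst f t) = dsubst (fun n => tr (f n)) (tr t).
Proof.
  assert (U : forall f M, dsubst (fun n => tr (@eup K f n)) M
                          = dsubst (dup (fun n => tr (f n))) M).
  { intros f M. apply dsubst_ext. intros [|m]; cbn; auto using tr_eren. }
  induction t; intros f; cbn;
    repeat match goal with IH : forall f, tr _ = _ |- _ => rewrite IH; clear IH end;
    rewrite ?U; reflexivity.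
Qed.

Lemma tr_esubst1 K (N M : eterm K) : tr (esubst1 N M) = dsubst1 (tr N) (tr M).
Proof.
  unfold esubst1, dsubst1. rewrite tr_esubst. apply dsubst_ext. now intros [|m].
Qed.

Lemma inv_tr K (t : eterm K) : inv (tr t) = t.
Proof. induction t; cbn; congruence. Qed.

Lemma invertible_tr K (t : eterm K) : invertible (tr t).
Proof. induction t; cbn; constructor; auto. Qed.

(** * Conversion *)

(** The source of all congruence properties below: [f] is a term constructor with all arguments but
    one held fixed. *)
Lemma rst_map A B (f : A -> B) (R : relation A) (R' : relation B) :
  (forall x y, R x y -> clos_refl_sym_trans _ R' (f x) (f y)) ->
  forall x y, clos_refl_sym_trans _ R x y ->
  clos_refl_sym_trans _ R' (f x) (f y).
Proof.
  intros H x y C. induction C.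
  - auto.
  - apply rst_refl.
  - now apply rst_sym.
  - eapply rst_trans; eassumption.
Qed.

(** * Congruence of EPTS conversion *)

Lemma econv_Pi K s1 s2 (A A' B B' : eterm K) :
  econv A A' -> econv B B' -> econv (EPi s1 s2 A B) (EPi s1 s2 A' B').
Proof.
  intros HA HB. apply rst_trans with (EPi s1 s2 A' B).
  - revert HA. apply (rst_map (f := fun X => EPi s1 s2 X B)).
    intros; apply rst_step; now constructor.
  - revert HB. apply (rst_map (f := fun X => EPi s1 s2 A' X)).
    intros; apply rst_step; now constructor.
Qed.

Lemma econv_Lam K s1 s2 (A A' B B' M M' : eterm K) :
  econv A A' -> econv B B' -> econv M M' ->
  econv (ELam s1 s2 A B M) (ELam s1 s2 A' B' M').
Proof.
  intros HA HB HM. apply rst_trans with (ELam s1 s2 A' B M).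
  - revert HA. apply (rst_map (f := fun X => ELam s1 s2 X B M)).
    intros; apply rst_step; now constructor.
  - apply rst_trans with (ELam s1 s2 A' B' M).
    + revert HB. apply (rst_map (f := fun X => ELam s1 s2 A' X M)).
      intros; apply rst_step; now constructor.
    + revert HM. apply (rst_map (f := fun X => ELam s1 s2 A' B' X)).
      intros; apply rst_step; now constructor.
Qed.

Lemma econv_App K s1 s2 (A A' B B' M M' N N' : eterm K) :
  econv A A' -> econv B B' -> econv M M' -> econv N N' ->
  econv (EApp s1 s2 A B M N) (EApp s1 s2 A' B' M' N').
Proof.
  intros HA HB HM HN. apply rst_trans with (EApp s1 s2 A' B M N).
  - revert HA. apply (rst_map (f := fun X => EApp s1 s2 X B M N)).
    intros; apply rst_step; now constructor.
  - apply rst_trans with (EApp s1 s2 A' B' M N).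
    + revert HB. apply (rst_map (f := fun X => EApp s1 s2 A' X M N)).
      intros; apply rst_step; now constructor.
    + apply rst_trans with (EApp s1 s2 A' B' M' N).
      * revert HM. apply (rst_map (f := fun X => EApp s1 s2 A' B' X N)).
        intros; apply rst_step; now constructor.
      * revert HN. apply (rst_map (f := fun X => EApp s1 s2 A' B' M' X)).
        intros; apply rst_step; now constructor.
Qed.

Lemma ered_eren K (M M' : eterm K) : ered M M' ->
  forall r, ered (eren r M) (eren r M').
Proof.
  induction 1; intros r; cbn; try (constructor; now auto).
  rewrite eren_esubst1. constructor.
Qed.

Lemma ered_esubst K (M M' : eterm K) : ered M M' ->
  forall f, ered (esubst f M) (esubst f M').
Proof.
  induction 1; intros f; cbn; try (constructor; now auto).
  rewrite esubst_esubst1. constructor.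
Qed.

Lemma econv_eup K (f g : nat -> eterm K) :
  (forall n, econv (f n) (g n)) -> forall n, econv (eup f n) (eup g n).
Proof.
  intros H [|m]; cbn; [apply rst_refl|].
  eapply rst_map; [| apply H].
  intros; apply rst_step; now apply ered_eren.
Qed.

(** One step in a substituted term is copied to each occurrence of its variable, possibly none, so
    the induction is on [M] and not on the conversion. *)
Lemma econv_esubst_pointwise K (M : eterm K) : forall f g,
  (forall n, econv (f n) (g n)) -> econv (esubst f M) (esubst g M).
Proof.
  induction M; intros f g H; cbn;
    [apply H | apply rst_refl | apply econv_Pi | apply econv_Lam | apply econv_App];
    auto using econv_eup.
Qed.

Lemma econv_esubst1 K (M M' N N' : eterm K) :
  econv M M' -> econv N N' -> econv (esubst1 N M) (esubst1 N' M').
Proof.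
  intros HM HN. apply rst_trans with (esubst1 N M').
  - eapply rst_map; [| exact HM].
    intros; apply rst_step; now apply ered_esubst.
  - apply econv_esubst_pointwise. intros [|m]; [exact HN | apply rst_refl].
Qed.

(** * Congruence of Dedukti conversion and of H-conversion *)

Definition dctxconv C (R : dterm C -> dterm C -> Prop) :=
  clos_refl_sym_trans _ (dctxclos R).

Lemma dctxconv_Pi C R (A A' B B' : dterm C) :
  dctxconv R A A' -> dctxconv R B B' -> dctxconv R (DPi A B) (DPi A' B').
Proof.
  intros HA HB. apply rst_trans with (DPi A' B).
  - revert HA. apply (rst_map (f := fun X => DPi X B)).
    intros; apply rst_step; now constructor.
  - revert HB. apply (rst_map (f := fun X => DPi A' X)).
    intros; apply rst_step; now constructor.
Qed.

Lemma dctxconv_Lam C R (A A' M M' : dterm C) :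
  dctxconv R A A' -> dctxconv R M M' -> dctxconv R (DLam A M) (DLam A' M').
Proof.
  intros HA HB. apply rst_trans with (DLam A' M).
  - revert HA. apply (rst_map (f := fun X => DLam X M)).
    intros; apply rst_step; now constructor.
  - revert HB. apply (rst_map (f := fun X => DLam A' X)).
    intros; apply rst_step; now constructor.
Qed.

Lemma dctxconv_App C R (M M' N N' : dterm C) :
  dctxconv R M M' -> dctxconv R N N' -> dctxconv R (DApp M N) (DApp M' N').
Proof.
  intros HA HB. apply rst_trans with (DApp M' N).
  - revert HA. apply (rst_map (f := fun X => DApp X N)).
    intros; apply rst_step; now constructor.
  - revert HB. apply (rst_map (f := fun X => DApp M' X)).
    intros; apply rst_step; now constructor.
Qed.

Lemma dctxconv_Con C R c (l l' : list (dterm C)) :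
  Forall2 (dctxconv R) l l' -> dctxconv R (DCon c l) (DCon c l').
Proof.
  intros H. change (dctxconv R (DCon c ([] ++ l)) (DCon c ([] ++ l'))).
  (* The arguments are converted from left to right; [k] is the prefix already converted. *)
  generalize (@nil (dterm C)). induction H; intros k; [apply rst_refl|].
  apply rst_trans with (DCon c (k ++ y :: l)).
  - revert H. apply (rst_map (f := fun X => DCon c (k ++ X :: l))).
    intros; apply rst_step; now constructor.
  - specialize (IHForall2 (k ++ [y])). now rewrite <- !app_assoc in IHForall2.
Qed.

Lemma dctxclos_mono C (R R' : dterm C -> dterm C -> Prop) :
  (forall M N, R M N -> dctxclos R' M N) ->
  forall M N, dctxclos R M N -> dctxclos R' M N.
Proof. induction 2; auto; now constructor. Qed.

Lemma dctxclos_dren C (R : dterm C -> dterm C -> Prop) :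
  (forall r M N, R M N -> R (dren r M) (dren r N)) ->
  forall M N, dctxclos R M N -> forall r, dctxclos R (dren r M) (dren r N).
Proof.
  intros H; induction 1; intros r; cbn; rewrite ?map_app; constructor; now auto.
Qed.

Lemma dconv_dren C (Th : dtheory C) (M N : dterm C) r :
  dconv Th M N -> dconv Th (dren r M) (dren r N).
Proof.
  apply rst_map. intros x y H. apply rst_step. apply dctxclos_dren; [|exact H].
  intros r' M0 N0 [[A M1 N1]|[l r0 f Hr]]; cbn.
  - left. rewrite dren_dsubst1. constructor.
  - right. rewrite !dren_dsubst. now constructor.
Qed.

Lemma Hconv_dconv (P : pts_spec) (M N : dterm (econst (sort P))) :
  Hconv M N -> dconv (EPTS P) M N.
Proof.
  apply (rst_map (f := fun X => X)). intros x y H. apply rst_step. revert H.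
  apply dctxclos_mono. intros ? ? []. now apply dcc_Lam_dom.
Qed.

(** The asymmetry is the point of H-conversion: an annotation may change by any conversion, a body
    only by H-conversion. *)
Lemma Hconv_Lam (P : pts_spec) (A A' M M' : dterm (econst (sort P))) :
  dconv (EPTS P) A A' -> Hconv M M' -> Hconv (DLam A M) (DLam A' M').
Proof.
  intros HA HM. apply rst_trans with (DLam A' M).
  - revert HA. apply (rst_map (f := fun X => DLam X M)).
    intros; apply rst_step; now constructor.
  - now apply dctxconv_Lam; [apply rst_refl|].
Qed.

Lemma Hconv_Prod (P : pts_spec) s1 s2 (A B : eterm (sort P)) A' T B' :
  Hconv (tr A) A' -> dconv (EPTS P) (DEl s1 (tr A)) T -> Hconv (tr B) B' ->
  Hconv (tr (EPi s1 s2 A B)) (DProd s1 s2 A' (DLam T B')).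
Proof.
  intros HA HT HB. apply dctxconv_Con.
  repeat (apply Forall2_cons || apply Forall2_nil);
    assumption || now apply Hconv_Lam.
Qed.

Lemma dconv_El (P : pts_spec) s (A A' : dterm (econst (sort P))) :
  dconv (EPTS P) A A' -> dconv (EPTS P) (DEl s A) (DEl s A').
Proof. intros H. apply dctxconv_Con. now apply Forall2_cons. Qed.

(** * Confluence of [beta + R] *)

(** Parallel reduction in the style of Tait and Martin-Löf. In [dpar_app] the four type arguments
    vanish from the contractum, so only [M] and [N] are reduced; [A] and [A'] are independent, which
    keeps the rule left-linear. *)
Inductive dpar (P : pts_spec) :
    dterm (econst (sort P)) -> dterm (econst (sort P)) -> Prop :=
| dpar_var n : dpar (DVar n) (DVar n)
| dpar_con c l l' : dpars l l' -> dpar (DCon c l) (DCon c l')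
| dpar_sort s : dpar (DSort s) (DSort s)
| dpar_Pi A A' B B' : dpar A A' -> dpar B B' -> dpar (DPi A B) (DPi A' B')
| dpar_Lam A A' M M' : dpar A A' -> dpar M M' -> dpar (DLam A M) (DLam A' M')
| dpar_App M M' N N' : dpar M M' -> dpar N N' -> dpar (DApp M N) (DApp M' N')
| dpar_beta A M M' N N' :
    dpar M M' -> dpar N N' -> dpar (DApp (DLam A M) N) (dsubst1 N' M')
| dpar_El s1 s2 : ax s1 s2 -> dpar (DEl s2 (Du s1)) (DU s1)
| dpar_app s1 s2 s3 A B A' B' M M' N N' : rl s1 s2 s3 ->
    dpar M M' -> dpar N N' ->
    dpar (Dapp s1 s2 A B (Dabs s1 s2 A' B' M) N) (DApp M' N')
with dpars (P : pts_spec) :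
    list (dterm (econst (sort P))) -> list (dterm (econst (sort P))) -> Prop :=
| dpars_nil : dpars [] []
| dpars_cons M M' l l' : dpar M M' -> dpars l l' -> dpars (M :: l) (M' :: l').

Scheme dpar_mind := Induction for dpar Sort Prop
with dpars_mind := Induction for dpars Sort Prop.
Combined Scheme dpar_dpars_ind from dpar_mind, dpars_mind.

#[local] Hint Constructors dpar dpars : dpar.

Lemma dpar_refl P (M : dterm (econst (sort P))) : dpar M M.
Proof.
  induction M using dterm_ind_list; auto with dpar.
  constructor. induction H; auto with dpar.
Qed.

Lemma dpars_refl P (l : list (dterm (econst (sort P)))) : dpars l l.
Proof. induction l; auto using dpar_refl with dpar. Qed.

#[local] Hint Resolve dpar_refl dpars_refl : dpar.

Lemma dpar_dpars_dren P :
  (forall M M' : dterm (econst (sort P)), dpar M M' ->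
     forall r, dpar (dren r M) (dren r M')) /\
  (forall l l' : list (dterm (econst (sort P))), dpars l l' ->
     forall r, dpars (map (dren r) l) (map (dren r) l')).
Proof.
  apply dpar_dpars_ind; intros; cbn; eauto with dpar.
  - rewrite dren_dsubst1. auto with dpar.
  - now apply dpar_El.
  - eapply dpar_app; eauto.
Qed.

Lemma dpar_dup P (f g : nat -> dterm (econst (sort P))) :
  (forall n, dpar (f n) (g n)) -> forall n, dpar (dup f n) (dup g n).
Proof.
  intros H [|m]; cbn; auto with dpar. now apply dpar_dpars_dren.
Qed.

Lemma dpar_dpars_dsubst P :
  (forall M M' : dterm (econst (sort P)), dpar M M' ->
     forall f g, (forall n, dpar (f n) (g n)) ->
     dpar (dsubst f M) (dsubst g M')) /\
  (forall l l' : list (dterm (econst (sort P))), dpars l l' ->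
     forall f g, (forall n, dpar (f n) (g n)) ->
     dpars (map (dsubst f) l) (map (dsubst g) l')).
Proof.
  apply dpar_dpars_ind; intros; cbn; eauto using dpar_dup with dpar.
  - rewrite dsubst_dsubst1. auto using dpar_dup with dpar.
  - now apply dpar_El.
  - eapply dpar_app; eauto.
Qed.

Lemma dpar_dsubst1 P (M M' N N' : dterm (econst (sort P))) :
  dpar M M' -> dpar N N' -> dpar (dsubst1 N M) (dsubst1 N' M').
Proof.
  intros HM HN. apply dpar_dpars_dsubst; auto.
  intros [|m]; auto with dpar.
Qed.

(** Only shapes that cannot be contracted at the root are inverted. [DApp], [DEl] and [Dapp] may be
    redexes, and their cases are split by hand. *)
Ltac inv_dpar :=
  repeat match goal with
  | H : dpar (DVar _) _ |- _ => inversion H; clear H; subst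
  | H : dpar (DSort _) _ |- _ => inversion H; clear H; subst
  | H : dpar (DPi _ _) _ |- _ => inversion H; clear H; subst
  | H : dpar (DLam _ _) _ |- _ => inversion H; clear H; subst
  | H : dpar (Du _) _ |- _ => inversion H; clear H; subst
  | H : dpar (DU _) _ |- _ => inversion H; clear H; subst
  | H : dpar (DProd _ _ _ _) _ |- _ => inversion H; clear H; subst
  | H : dpar (Dabs _ _ _ _ _) _ |- _ => inversion H; clear H; subst
  | H : dpar (DCon (cabs _ _) _) _ |- _ => inversion H; clear H; subst
  | H : dpars [] _ |- _ => inversion H; clear H; subst
  | H : dpars (_ :: _) _ |- _ => inversion H; clear H; subst
  end.

(** The rules are left-linear and overlap neither each other nor beta. The delicate cases oppose a
    congruence step to a root contraction, where the redex must be seen to survive. *)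
Lemma dpar_dpars_diamond P :
  (forall M M1 : dterm (econst (sort P)), dpar M M1 ->
     forall M2, dpar M M2 -> exists M3, dpar M1 M3 /\ dpar M2 M3) /\
  (forall l l1 : list (dterm (econst (sort P))), dpars l l1 ->
     forall l2, dpars l l2 -> exists l3, dpars l1 l3 /\ dpars l2 l3).
Proof.
  apply dpar_dpars_ind.
  - intros n M2 H. inv_dpar. eauto with dpar.
  - intros c l l1 Hl IH M2 H. inversion H; subst.
    + clear Hl. edestruct IH as (l3 & ? & ?); [eassumption|]. eauto with dpar.
    + inv_dpar. exists (DU s1). auto with dpar.
    (* The second step contracts the root. The induction hypothesis receives the argument list in
       which only [M] and [N] are reduced, so the common reduct still contains [abs] and is still a
       redex. *)
    + destruct (IH [A; B; Dabs s1 s2 A' B' M'; N']) as (l3 & ? & ?).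
      { repeat (constructor; auto with dpar). }
      inv_dpar. eexists. split; [eapply dpar_app | apply dpar_App]; eassumption.
  - intros s M2 H. inv_dpar. eauto with dpar.
  - intros A A1 B B1 _ IHA _ IHB M2 H. inv_dpar.
    edestruct IHA as (? & ? & ?); [eassumption|].
    edestruct IHB as (? & ? & ?); [eassumption|].
    eauto with dpar.
  - intros A A1 B B1 _ IHA _ IHB M2 H. inv_dpar.
    edestruct IHA as (? & ? & ?); [eassumption|].
    edestruct IHB as (? & ? & ?); [eassumption|].
    eauto with dpar.
  - intros M M1 N N1 HM IHM _ IHN M2 H. inversion H; subst.
    + clear HM. edestruct IHM as (? & ? & ?); [eassumption|].
      edestruct IHN as (? & ? & ?); [eassumption|].
      eauto with dpar.
    (* As for [app]: the abstraction is kept and only its body reduced, so that the beta-redex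
       survives. *)
    + destruct (IHM (DLam A M')) as (? & ? & ?); auto with dpar.
      edestruct IHN as (? & ? & ?); [eassumption|]. inv_dpar.
      eauto using dpar_dsubst1 with dpar.
  - intros A M M1 N N1 _ IHM _ IHN M2 H. inversion H; subst.
    + inv_dpar.
      edestruct IHM as (? & ? & ?); [eassumption|].
      edestruct IHN as (? & ? & ?); [eassumption|].
      eauto using dpar_dsubst1 with dpar.
    + edestruct IHM as (? & ? & ?); [eassumption|].
      edestruct IHN as (? & ? & ?); [eassumption|].
      eauto using dpar_dsubst1 with dpar.
  - intros s1 s2 Ha M2 H. inversion H; subst; inv_dpar; eauto with dpar.
    exists (DU s1). split; auto with dpar. now apply dpar_El.
  - intros s1 s2 s3 A B A' B' M M1 N N1 Hr _ IHM _ IHN M2 H.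
    inversion H; subst.
    + inv_dpar.
      edestruct IHM as (? & ? & ?); [eassumption|].
      edestruct IHN as (? & ? & ?); [eassumption|].
      eexists. split; [apply dpar_App | eapply dpar_app]; eassumption.
    + edestruct IHM as (? & ? & ?); [eassumption|].
      edestruct IHN as (? & ? & ?); [eassumption|].
      eauto with dpar.
  - intros l2 H. inv_dpar. eauto with dpar.
  - intros M M1 l l1 _ IHM _ IHl l2 H. inv_dpar.
    edestruct IHM as (? & ? & ?); [eassumption|].
    edestruct IHl as (? & ? & ?); [eassumption|].
    eauto with dpar.
Qed.

(** * From the diamond property to confluence *)

Definition dparstar (P : pts_spec) := clos_refl_trans_1n _ (@dpar P).

Lemma dparstar_step P (M N Q : dterm (econst (sort P))) :
  dpar M N -> dparstar N Q -> dparstar M Q.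
Proof. intros. econstructor; eassumption. Qed.

Lemma dparstar_trans P (M N Q : dterm (econst (sort P))) :
  dparstar M N -> dparstar N Q -> dparstar M Q.
Proof.
  induction 1 as [|M M1 N H _ IH]; intros HQ; [exact HQ|].
  eapply dparstar_step; [exact H | now apply IH].
Qed.

Lemma dparstar_strip P (M N1 : dterm (econst (sort P))) :
  dparstar M N1 -> forall N2, dpar M N2 ->
  exists Z, dpar N1 Z /\ dparstar N2 Z.
Proof.
  induction 1 as [M|M M1 N1 H _ IH]; intros N2 H2.
  - exists N2. split; auto. constructor.
  - destruct (proj1 (dpar_dpars_diamond P) _ _ H _ H2) as (Z & HZ1 & HZ2).
    destruct (IH _ HZ1) as (Z' & ? & ?). exists Z'. split; auto.
    eapply dparstar_step; eauto.
Qed.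

Lemma dparstar_confluent P (M N1 : dterm (econst (sort P))) :
  dparstar M N1 -> forall N2, dparstar M N2 ->
  exists Z, dparstar N1 Z /\ dparstar N2 Z.
Proof.
  intros H1 N2 H2. revert N1 H1.
  induction H2 as [M|M M2 N2 H _ IH]; intros N1 H1.
  - exists N1. split; auto. constructor.
  - destruct (dparstar_strip H1 H) as (Z & HZ1 & HZ2).
    destruct (IH _ HZ2) as (Z' & ? & ?). exists Z'. split; auto.
    eapply dparstar_step; eauto.
Qed.

Lemma dred_dpar P (M N : dterm (econst (sort P))) : dred (EPTS P) M N -> dpar M N.
Proof.
  induction 1 as [t t' H|c l1 t t' l2 _ IH| | | | | |]; auto with dpar.
  - destruct H as [[A M N]|[l r f [s1 s2 Ha|s1 s2 s3 Hr]]]; cbn.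
    + auto with dpar.
    + now apply dpar_El.
    + eapply dpar_app; eauto with dpar.
  - constructor. induction l1; cbn; auto with dpar.
Qed.

Lemma dconv_join P (M N : dterm (econst (sort P))) :
  dconv (EPTS P) M N -> exists Z, dparstar M Z /\ dparstar N Z.
Proof.
  induction 1 as [M N H|M|M N _ (Z & ? & ?)|M N Q _ (Z1 & H1 & H2) _ (Z2 & H3 & H4)].
  - exists N. split; [|constructor]. eapply dparstar_step; [|constructor].
    now apply dred_dpar.
  - exists M. split; constructor.
  - eauto.
  - destruct (dparstar_confluent H2 H3) as (Z & ? & ?).
    exists Z. split; eapply dparstar_trans; eauto.
Qed.

Lemma dpar_dconv P (M N : dterm (econst (sort P))) :
  dpar M N -> dconv (EPTS P) M N.
Proof.
  revert M N. apply (@dpar_mind P (fun M N _ => dconv (EPTS P) M N)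
    (fun l l' _ => Forall2 (dconv (EPTS P)) l l')); intros.
  - apply rst_refl.
  - now apply dctxconv_Con.
  - apply rst_refl.
  - now apply dctxconv_Pi.
  - now apply dctxconv_Lam.
  - now apply dctxconv_App.
  - apply rst_trans with (DApp (DLam A M') N').
    + apply dctxconv_App; auto. apply dctxconv_Lam; auto. apply rst_refl.
    + apply rst_step, dcc_root. left. constructor.
  - apply rst_step, dcc_root. right.
    (* The rule is closed, so any substitution instantiates it. *)
    apply (@drule_root_intro _ (EPTS P) (DEl s2 (Du s1)) (DU s1) DVar).
    now constructor.
  - apply rst_trans with (DApp M N); [|now apply dctxconv_App].
    apply rst_step, dcc_root. right.
    apply (@drule_root_intro _ (EPTS P)
      (Dapp s1 s2 (DVar 0) (DVar 1)
         (Dabs s1 s2 (DVar 2) (DVar 3) (DVar 4)) (DVar 5))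
      (DApp (DVar 4) (DVar 5))
      (* The list gives the values of the pattern variables 0 to 5; the default is never reached on
         the rule. *)
      (fun n => nth n [A; B; A'; B'; M; N] (DVar n))).
    econstructor; eauto.
  - constructor.
  - now constructor.
Qed.

Lemma dparstar_dconv P (M N : dterm (econst (sort P))) :
  dparstar M N -> dconv (EPTS P) M N.
Proof.
  induction 1; [apply rst_refl|].
  eapply rst_trans; [apply dpar_dconv; eassumption | eassumption].
Qed.

(** * Reducts of types and separation of their heads *)

Lemma dparstar_Pi P (A B Z : dterm (econst (sort P))) :
  dparstar (DPi A B) Z ->
  exists A' B', Z = DPi A' B' /\ dparstar A A' /\ dparstar B B'.
Proof.
  intros H. remember (DPi A B) as M eqn:E. revert A B E.
  induction H as [M|M M1 Z H _ IH]; intros A B ->.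
  - exists A, B. repeat split; constructor.
  - inv_dpar. edestruct IH as (A1 & B1 & -> & ? & ?); [reflexivity|].
    exists A1, B1. repeat split; eapply dparstar_step; eauto.
Qed.

Lemma dparstar_U P s (Z : dterm (econst (sort P))) :
  dparstar (DU s) Z -> Z = DU s.
Proof.
  intros H. remember (DU s) as M eqn:E. induction H; subst; auto.
  inv_dpar. auto.
Qed.

(** [El] is contracted only once its argument has become a code [u], and the resulting [U] admits no
    further proper reduction. *)
Lemma dparstar_El P s (A Z : dterm (econst (sort P))) :
  dparstar (DEl s A) Z ->
  (exists A', Z = DEl s A' /\ dparstar A A') \/
  (exists s', Z = DU s' /\ ax s' s /\ dparstar A (Du s')).
Proof.
  intros H. remember (DEl s A) as M eqn:E. revert A E.
  induction H as [M|M M1 Z H H' IH]; intros A ->.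
  - left. exists A. split; constructor.
  - inversion H; subst.
    + inv_dpar. edestruct IH as [(A1 & -> & ?)|(s' & -> & ? & ?)];
        [reflexivity| |].
      * left. exists A1. split; auto. eapply dparstar_step; eauto.
      * right. exists s'. repeat split; auto. eapply dparstar_step; eauto.
    + apply dparstar_U in H' as ->. right. exists s1. repeat split; auto.
      constructor.
Qed.

Lemma dconv_Pi_inj P (A A' B B' : dterm (econst (sort P))) :
  dconv (EPTS P) (DPi A B) (DPi A' B') ->
  dconv (EPTS P) A A' /\ dconv (EPTS P) B B'.
Proof.
  intros H. apply dconv_join in H as (Z & H1 & H2).
  apply dparstar_Pi in H1 as (A1 & B1 & -> & ? & ?).
  apply dparstar_Pi in H2 as (A2 & B2 & E & ? & ?). injection E as <- <-.
  split; (eapply rst_trans; [|apply rst_sym]); apply dparstar_dconv; eassumption.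
Qed.

Inductive head_kind : Type := HPi | HSort | HBase | HOther.

(* [El_s A] and [U_s] share a kind, because the former may reduce to the latter. *)
Definition head (K : Type) (T : dterm (econst K)) : head_kind :=
  match T with
  | DPi _ _ => HPi
  | DSort _ => HSort
  | DCon (cU _) _ | DCon (cEl _) _ => HBase
  | _ => HOther
  end.

(** Products and sorts are never contracted at the root, and the only root contraction of a base
    type turns [El] into [U], of the same kind. The kind [HOther] collects the terms whose head may
    change. *)
Lemma dpar_head P (T T' : dterm (econst (sort P))) :
  dpar T T' -> head T <> HOther -> head T' = head T.
Proof. destruct 1; cbn; congruence. Qed.

Lemma dparstar_head P (T T' : dterm (econst (sort P))) :
  dparstar T T' -> head T <> HOther -> head T' = head T.
Proof.
  induction 1 as [T|T T1 T2 H _ IH]; intros N; auto.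
  pose proof (dpar_head H N) as E. rewrite IH; congruence.
Qed.

Lemma dconv_head P (T T' : dterm (econst (sort P))) :
  dconv (EPTS P) T T' -> head T <> HOther -> head T' <> HOther ->
  head T = head T'.
Proof.
  intros H N N'. apply dconv_join in H as (Z & H1 & H2).
  rewrite <- (dparstar_head H1 N). now apply dparstar_head.
Qed.

Ltac head_clash :=
  exfalso;
  match goal with H : dconv _ ?T ?T' |- _ =>
    let E := fresh in
    assert (E : head T = head T') by (apply dconv_head; [exact H | discriminate..]);
    discriminate E
  end.

(** * Invertible forms and reflection of conversion *)

Lemma invertible_dren K (M : dterm (econst K)) : invertible M ->
  forall r, invertible (dren r M) /\ inv (dren r M) = eren r (inv M).
Proof.
  induction 1; intros r;
    repeat match goal with IH : forall r, _ /\ _ |- _ =>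
      pose proof (IH r); pose proof (IH (upren r)); clear IH end;
    cbn; rewrite ?eren_esubst1; intuition (try constructor; auto; congruence).
Qed.

Lemma invertible_dup K (f : nat -> dterm (econst K)) :
  (forall n, invertible (f n)) -> forall n, invertible (dup f n).
Proof. intros H [|m]; cbn; [constructor|]. now apply invertible_dren. Qed.

(** Annotations may become anything under [f]: neither [invertible] nor [inv] looks at them. A
    framework redex is handled by commuting the two EPTS substitutions. *)
Lemma invertible_dsubst K (M : dterm (econst K)) : invertible M ->
  forall f, (forall n, invertible (f n)) ->
  invertible (dsubst f M) /\
  inv (dsubst f M) = esubst (fun n => inv (f n)) (inv M).
Proof.
  assert (U : forall f t, (forall n, invertible (f n)) ->
    esubst (fun n => inv (@dup (econst K) f n)) t
    = esubst (eup (fun n => inv (f n))) t).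
  { intros f t H. apply esubst_ext. intros [|m]; cbn; auto.
    now apply invertible_dren. }
  induction 1; intros f Hf;
    repeat match goal with IH : forall f, _ -> _ /\ _ |- _ =>
      pose proof (IH f Hf); pose proof (IH _ (invertible_dup Hf)); clear IH end;
    rewrite ?U in * by assumption;
    cbn; rewrite ?esubst_esubst1;
    intuition (try constructor; auto; congruence).
Qed.

Lemma invertible_dsubst1 K (M N : dterm (econst K)) :
  invertible M -> invertible N ->
  invertible (dsubst1 N M) /\ inv (dsubst1 N M) = esubst1 (inv N) (inv M).
Proof.
  intros HM HN. unfold dsubst1, esubst1.
  edestruct (invertible_dsubst HM) as (H1 & H2);
    [| split; [exact H1 | rewrite H2]].
  - intros [|m]; [exact HN | constructor].
  - apply esubst_ext. now intros [|m].
Qed.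

(** [inv] already contracts framework redexes and erases annotations, so a beta step is invisible up
    to conversion of the subterms. A step of the [app] rule becomes an EPTS beta step, and its
    contractum is invertible because the last argument of [abs] is an abstraction. *)
Lemma invertible_dpar P (M : dterm (econst (sort P))) : invertible M ->
  forall M', dpar M M' -> invertible M' /\ econv (inv M) (inv M').
Proof.
  induction 1 as [n|s|s1 s2 A T1 B T2 M _ IHA _ IHB _ IHM
                 |T M N _ IHM _ IHN|s1 s2 A T1 B _ IHA _ IHB
                 |s1 s2 A T1 B M N _ IHA _ IHB HM IHM _ IHN]; intros M1 H.
  - inv_dpar. split; [constructor | apply rst_refl].
  - inv_dpar. split; [constructor | apply rst_refl].
  - inv_dpar.
    edestruct IHA as (? & ?); [eassumption|].
    edestruct IHB as (? & ?); [eassumption|].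
    edestruct IHM as (? & ?); [eassumption|].
    split; [now constructor | now apply econv_Lam].
  - inversion H; subst; inv_dpar;
      (edestruct IHM as (? & ?); [eassumption|]);
      (edestruct IHN as (? & ?); [eassumption|]).
    + split; [now constructor | now apply econv_esubst1].
    + edestruct (@invertible_dsubst1 _ M' N') as (? & E); auto.
      split; auto. rewrite E. now apply econv_esubst1.
  - inv_dpar.
    edestruct IHA as (? & ?); [eassumption|].
    edestruct IHB as (? & ?); [eassumption|].
    split; [now constructor | now apply econv_Pi].
  - inversion H; subst.
    + inv_dpar.
      edestruct IHA as (? & ?); [eassumption|].
      edestruct IHB as (? & ?); [eassumption|].
      edestruct IHM as (? & ?); [eassumption|].
      edestruct IHN as (? & ?); [eassumption|].
      split; [now constructor | now apply econv_App].
    + inversion HM; subst. inv_dpar.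
      (* The contraction says nothing about the type arguments of [abs], so they are left in place
         and only its last argument is reduced. *)
      edestruct IHM as (HI & HC).
      { apply dpar_con. apply dpars_cons; [apply dpar_refl|].
        apply dpars_cons; [apply dpar_refl|].
        apply dpars_cons; [|constructor].
        apply dpar_Lam; eassumption. }
      edestruct IHN as (? & ?); [eassumption|].
      inversion HI; subst. split; [now constructor|].
      eapply rst_trans; [apply econv_App; [apply rst_refl..| exact HC | eassumption]|].
      apply rst_step, ered_beta.
Qed.

Lemma invertible_dparstar P (M M' : dterm (econst (sort P))) :
  dparstar M M' -> invertible M -> invertible M' /\ econv (inv M) (inv M').
Proof.
  induction 1 as [M|M M1 M2 H _ IH]; intros HI.
  - split; auto. apply rst_refl.
  - destruct (invertible_dpar HI H) as (HI1 & HC).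
    destruct (IH HI1) as (? & ?). split; auto. eapply rst_trans; eauto.
Qed.

Lemma dparstar_tr_econv P (A : eterm (sort P)) Z :
  dparstar (tr A) Z -> econv A (inv Z).
Proof.
  intros H. rewrite <- (inv_tr A) at 1.
  apply invertible_dparstar; auto using invertible_tr.
Qed.

(** By confluence the two types meet either in an [El], whose argument is a common reduct, or in
    some [U], and then both arguments reduce to the same code. Applying [inv] to the common reduct
    gives the conversion. *)
Lemma dconv_El_tr P s s' (A B : eterm (sort P)) :
  dconv (EPTS P) (DEl s (tr A)) (DEl s' (tr B)) -> econv A B.
Proof.
  intros H. apply dconv_join in H as (Z & H1 & H2).
  apply dparstar_El in H1 as [(A' & -> & H1)|(s1 & -> & _ & H1)];
    apply dparstar_El in H2 as [(B' & E & H2)|(s2 & E & _ & H2)];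
    try discriminate E; injection E; intros; subst;
    apply dparstar_tr_econv in H1, H2;
    eapply rst_trans; [exact H1 | now apply rst_sym
                      | exact H1 | now apply rst_sym].
Qed.

Lemma dconv_El_tr_U P s s' (A : eterm (sort P)) :
  dconv (EPTS P) (DEl s (tr A)) (DU s') -> ax s' s /\ econv A (ESort s').
Proof.
  intros H. apply dconv_join in H as (Z & H1 & H2).
  apply dparstar_U in H2 as ->.
  apply dparstar_El in H1 as [(A' & E & _)|(s1 & E & ? & H1)]; [discriminate E|].
  injection E as ->. split; auto. now apply dparstar_tr_econv in H1.
Qed.

Lemma dconv_U_inj P s s' :
  dconv (EPTS P) (DU s) (DU s') -> s = s'.
Proof.
  intros H. apply dconv_join in H as (Z & H1 & H2).
  apply dparstar_U in H1 as ->. apply dparstar_U in H2. now injection H2.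
Qed.

(** * Generation *)

(** The final uses of the conversion rule are collected into one conversion. For applications only
    the product type of the function is recorded, which suffices to rule them out. *)
Lemma dty_generation C (Th : dtheory C) D M T : dty Th D M T ->
  match M with
  | DVar n => exists A, nth_error D n = Some A /\
      dconv Th (dren (fun i => i + S n) A) T
  | DCon c l => exists L A, dsig Th c L A /\ dargs Th D l L /\
      dconv Th (dinst l A) T
  | DSort _ => dconv Th (DSort KIND) T
  | DPi _ _ => exists s, dconv Th (DSort s) T
  | DLam A N => exists B, dty Th (A :: D) N B /\ dconv Th (DPi A B) T
  | DApp N _ => exists A B, dty Th D N (DPi A B)
  end.
Proof.
  induction 1 as [D M A B s _ IH _ _ E| | | | | |].
  - destruct M.
    + destruct IH as (? & ? & ?). eexists; split; [|eapply rst_trans]; eauto.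
    + destruct IH as (? & ? & ? & ? & ?).
      do 2 eexists; repeat split; [..|eapply rst_trans]; eauto.
    + eapply rst_trans; eauto.
    + destruct IH as (? & ?). eexists; eapply rst_trans; eauto.
    + destruct IH as (? & ? & ?). eexists; split; [|eapply rst_trans]; eauto.
    + exact IH.
  - eexists; split; [eassumption | apply rst_refl].
  - apply rst_refl.
  - do 2 eexists; repeat split; [eassumption.. | apply rst_refl].
  - eexists; apply rst_refl.
  - eexists; split; [eassumption | apply rst_refl].
  - do 2 eexists; eassumption.
Qed.

(** * Contexts up to conversion and the main induction *)

(** Going under a binder of [M] pushes its own annotation on the Dedukti side, and this annotation
    is known only up to conversion. *)
Inductive ctxrel (P : pts_spec) :
    ectx (sort P) -> dctx (econst (sort P)) -> Prop :=
| ctxrel_nil : ctxrel [] []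
| ctxrel_cons G D A T s :
    ctxrel G D -> ety G A (ESort s) -> dconv (EPTS P) T (DEl s (tr A)) ->
    ctxrel (A :: G) (T :: D).

Lemma trctx_ctxrel P (G : ectx (sort P)) D : trctx G D -> ctxrel G D.
Proof. induction 1; econstructor; eauto. apply rst_refl. Qed.

Lemma ctxrel_ewf P (G : ectx (sort P)) D : ctxrel G D -> ewf G.
Proof. destruct 1; econstructor; eauto. Qed.

Lemma ctxrel_nth P (G : ectx (sort P)) D : ctxrel G D ->
  forall n T, nth_error D n = Some T ->
  exists A s, nth_error G n = Some A /\ dconv (EPTS P) T (DEl s (tr A)).
Proof.
  induction 1 as [|G D A T s _ IH _ HT]; intros [|n] T' E; try discriminate E.
  - injection E as <-. exists A, s. split; [reflexivity | exact HT].
  - now apply IH.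
Qed.

(** The second case covers top-sorts, which have no [El] form. Both cases hold at once for a
    well-typed sort, by the rule on [El]. *)
Definition target (P : pts_spec) (G : ectx (sort P)) (A : eterm (sort P))
    (T : dterm (econst (sort P))) : Prop :=
  (exists s, ety G A (ESort s) /\ dconv (EPTS P) T (DEl s (tr A))) \/
  (exists s, A = ESort s /\ dconv (EPTS P) T (DU s)).

Lemma target_head P (G : ectx (sort P)) A T T' :
  target G A T -> dconv (EPTS P) T' T -> head T' <> HOther -> head T' = HBase.
Proof.
  intros [(s & _ & E)|(s & _ & E)] E' N;
    [change HBase with (head (DEl s (tr A))) | change HBase with (head (DU s))];
    (apply dconv_head; [eapply rst_trans; eassumption | assumption | discriminate]).
Qed.

Lemma ety_target_El P (G : ectx (sort P)) M A B T s :
  ewf G -> ety G M B -> dconv (EPTS P) (DEl s (tr B)) T -> target G A T ->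
  ety G M A.
Proof.
  intros HG HM E [(s' & HA & E')|(s' & -> & E')];
    pose proof (rst_trans _ _ _ _ _ E E') as E2.
  - eapply ety_conv; eauto. eapply dconv_El_tr; eauto.
  (* An [El] type converts to the [U] of a sort only if that sort has an axiom, which provides the
     typing required by the conversion rule. *)
  - apply dconv_El_tr_U in E2 as (? & ?).
    apply ety_conv with B s; auto. now apply ety_sort.
Qed.

Lemma ety_target_U P (G : ectx (sort P)) M A T s :
  ety G M (ESort s) -> dconv (EPTS P) (DU s) T -> target G A T -> ety G M A.
Proof.
  intros HM E [(s' & HA & E')|(s' & -> & E')];
    pose proof (rst_trans _ _ _ _ _ E E') as E2.
  - apply rst_sym, dconv_El_tr_U in E2 as (? & ?).
    eapply ety_conv; eauto. now apply rst_sym.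
  (* The sorts coincide, so no conversion takes place; this is what admits a top-sort as type. *)
  - apply dconv_U_inj in E2 as ->. exact HM.
Qed.

(** * Normal forms of product type *)

Lemma beta_normal_con C c (l1 l2 : list (dterm C)) M :
  beta_normal (DCon c (l1 ++ M :: l2)) -> beta_normal M.
Proof. intros H (M' & ?). apply H. eexists. apply dcc_con. eassumption. Qed.

Lemma beta_normal_Lam C (A M : dterm C) : beta_normal (DLam A M) -> beta_normal M.
Proof. intros H (M' & ?). apply H. eexists. apply dcc_Lam_body. eassumption. Qed.

Lemma beta_normal_App_fun C (M N : dterm C) : beta_normal (DApp M N) -> beta_normal M.
Proof. intros H (M' & ?). apply H. eexists. apply dcc_App_fun. eassumption. Qed.

Lemma beta_normal_Pi_Lam P (G : ectx (sort P)) D M : ctxrel G D ->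
  beta_normal M -> forall A B, dty (EPTS P) D M (DPi A B) ->
  exists T N, M = DLam T N.
Proof.
  intros HD. induction M as [n|c l|s|A1 B1|A1 M1|M1 IH N]; intros HN A B H;
    apply dty_generation in H.
  - destruct H as (T & Hn & E).
    destruct (ctxrel_nth HD Hn) as (A' & s & _ & E').
    apply (dconv_dren (fun i => i + S n)) in E'.
    assert (E2 : dconv (EPTS P) (DEl s (dren (fun i => i + S n) (tr A'))) (DPi A B))
      by (eapply rst_trans; [apply rst_sym|]; eassumption).
    head_clash.
  - destruct H as (L & A' & Hs & _ & E). destruct Hs; cbn in E; head_clash.
  - head_clash.
  - destruct H as (s & E). head_clash.
  - eauto.
  (* The function part is normal and has a product type, hence is an abstraction, and the
     application would be a beta-redex. *)
  - destruct H as (A' & B' & H).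
    destruct (IH (beta_normal_App_fun HN) _ _ H) as (T & N' & ->).
    exfalso. apply HN. eexists. apply dcc_root. constructor.
Qed.

Lemma beta_normal_Pi_body P (G : ectx (sort P)) D M A B : ctxrel G D ->
  beta_normal M -> dty (EPTS P) D M (DPi A B) ->
  exists T N B', M = DLam T N /\ beta_normal N /\
    dconv (EPTS P) T A /\ dconv (EPTS P) B' B /\ dty (EPTS P) (T :: D) N B'.
Proof.
  intros HD HN H. destruct (beta_normal_Pi_Lam HD HN H) as (T & N & ->).
  apply dty_generation in H as (B' & H & E).
  apply dconv_Pi_inj in E as (? & ?).
  exists T, N, B'. repeat split; eauto using beta_normal_Lam.
Qed.

Lemma beta_normal_no_App P (G : ectx (sort P)) D M N T : ctxrel G D ->
  beta_normal (DApp M N) -> ~ dty (EPTS P) D (DApp M N) T.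
Proof.
  intros HD HN H. apply dty_generation in H as (A & B & H).
  destruct (beta_normal_Pi_Lam HD (beta_normal_App_fun HN) H) as (T' & M' & ->).
  apply HN. eexists. apply dcc_root. constructor.
Qed.

(** * Argument lists and the induction on size *)

Lemma dargs_cons_inv C (Th : dtheory C) D l A L : dargs Th D l (A :: L) ->
  exists l' N, l = l' ++ [N] /\ dargs Th D l' L /\ dty Th D N (dinst l' A).
Proof. inversion 1; subst. eauto. Qed.

Lemma dargs_nil_inv C (Th : dtheory C) D l : dargs Th D l [] -> l = [].
Proof. now inversion 1. Qed.

Ltac inv_dargs :=
  repeat match goal with
  | H : dargs _ _ ?l (_ :: _) |- _ =>
      let N := fresh "N" in let HN := fresh "HN" in
      apply dargs_cons_inv in H as (? & N & -> & H & HN)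
  | H : dargs _ _ ?l [] |- _ => apply dargs_nil_inv in H as ->
  end.

(** A measure replaces structural induction because the induction jumps from a constant to the
    bodies of the abstractions among its arguments. *)
Fixpoint dsize C (M : dterm C) : nat :=
  match M with
  | DVar _ | DSort _ => 1
  | DCon _ l => S (list_sum (map (@dsize C) l))
  | DPi A B | DLam A B | DApp A B => S (dsize A + dsize B)
  end.

Lemma conservativity_up_to_conversion P n : forall (G : ectx (sort P)) D A M T,
  dsize M < n -> ctxrel G D -> beta_normal M -> dty (EPTS P) D M T ->
  target G A T ->
  invertible M /\ ety G (inv M) A /\ Hconv (tr (inv M)) M.
Proof.
  induction n as [|n IH]; [lia|]. intros G D A M T Hn HD HN HM HT.
  pose proof (ctxrel_ewf HD) as HG.
  assert (HU : forall X s, dsize X < n -> beta_normal X ->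
    dty (EPTS P) D X (DU s) ->
    invertible X /\ ety G (inv X) (ESort s) /\ Hconv (tr (inv X)) X).
  { intros X s ? ? ?. eapply IH; eauto. right. exists s. split; auto.
    apply rst_refl. }
  (* The family argument [B : El_s1 A -> U_s2] common to Prod, abs and app. *)
  assert (HB : forall A0 X s1 s2, dsize X < n -> beta_normal X ->
    ety G (inv A0) (ESort s1) -> Hconv (tr (inv A0)) A0 ->
    dty (EPTS P) D X (DPi (DEl s1 A0) (DU s2)) ->
    exists T1 B, X = DLam T1 B /\ invertible B /\
      ety (inv A0 :: G) (inv B) (ESort s2) /\
      Hconv (tr (inv B)) B /\ dconv (EPTS P) (DEl s1 (tr (inv A0))) T1).
  { intros A0 X s1 s2 Hs HX HA0 HC H.
    destruct (beta_normal_Pi_body HD HX H) as (T1 & B & C & -> & ? & E1 & E2 & HB).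
    (* The annotation [T1] is tied to the type read back from [A0], so the context extended with
       [T1] is still related to the EPTS one. *)
    assert (E : dconv (EPTS P) (DEl s1 (tr (inv A0))) T1).
    { eapply rst_trans; [apply dconv_El, Hconv_dconv, HC | now apply rst_sym]. }
    destruct (IH (inv A0 :: G) (T1 :: D) (ESort s2) B C) as (? & ? & ?); auto.
    - cbn in Hs. lia.
    - econstructor; eauto. now apply rst_sym.
    - right. eauto.
    - exists T1, B. auto 10. }
  destruct M as [k|c l|s|A1 B1|A1 M1|M1 N1].
  - apply dty_generation in HM as (Tk & Hk & E).
    destruct (ctxrel_nth HD Hk) as (Ak & s & HGk & E').
    split; [constructor|]. split; [|apply rst_refl]. cbn.
    eapply ety_target_El; [exact HG | exact (ety_var HG HGk) | | exact HT].
    rewrite tr_eren. eapply rst_trans; [|exact E].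
    apply rst_sym, (dconv_dren (fun i => i + S k)) in E'. exact E'.
  - apply dty_generation in HM as (L & C & Hs & Ha & E).
    destruct Hs as [s|s|s1 s2 Hax|s1 s2 s3 Hrl|s1 s2 s3 Hrl|s1 s2 s3 Hrl];
      inv_dargs; cbn in *.
    (* [U] and [El] themselves have type [TYPE], which is not a base type. *)
    + pose proof (target_head HT E) as H. discriminate H; discriminate.
    + pose proof (target_head HT E) as H. discriminate H; discriminate.
    + split; [constructor|]. split; [|apply rst_refl].
      eapply ety_target_U; eauto. now constructor.
    + rename N0 into A0, N into B0, HN1 into HA0, HN0 into HB0.
      destruct (HU A0 s1) as (IA & TA & CA); auto; [lia|..].
      { exact (@beta_normal_con _ _ [] [B0] _ HN). }
      destruct (HB A0 B0 s1 s2) as (T1 & B & -> & IB & TB & CB & E1); auto; [lia|..].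
      { exact (@beta_normal_con _ _ [A0] [] _ HN). }
      split; [now constructor|]. split.
      * eapply ety_target_U; [eapply ety_prod; eauto | exact E | exact HT].
      * now apply Hconv_Prod.
    + rename N1 into A0, N0 into B0, N into M0, HN2 into HA0, HN1 into HB0, HN0 into HM0.
      destruct (HU A0 s1) as (IA & TA & CA); auto; [lia|..].
      { exact (@beta_normal_con _ _ [] [B0; M0] _ HN). }
      destruct (HB A0 B0 s1 s2) as (T1 & B & -> & IB & TB & CB & E1); auto; [lia|..].
      { exact (@beta_normal_con _ _ [A0] [M0] _ HN). }
      edestruct (@beta_normal_Pi_body P G D M0) as (T2 & M & C & -> & NM & E2 & EC & HM);
        [exact HD | exact (@beta_normal_con _ _ [A0; DLam T1 B] [] _ HN) | exact HM0 |].
      assert (E3 : dconv (EPTS P) (DEl s1 (tr (inv A0))) T2).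
      { eapply rst_trans; [apply dconv_El, Hconv_dconv, CA | now apply rst_sym]. }
      destruct (IH (inv A0 :: G) (T2 :: D) (inv B) M C) as (IM & TM & CM); auto.
      { cbn in Hn. lia. }
      { econstructor; eauto. now apply rst_sym. }
      (* The declared type of the body is [El] of the weakened family applied to the bound variable;
         it beta-reduces to [El] of [B], and [B] is H-convertible to its read-back. *)
      { left. exists s2. split; auto. eapply rst_trans; [exact EC|].
        apply dconv_El. apply rst_trans with B.
        - rewrite <- (dsubst1_var0_shift B) at 2.
          apply rst_step, dcc_root. left. constructor.
        - now apply rst_sym, Hconv_dconv. }
      split; [now constructor|]. split.
      * eapply ety_target_El with (B := EPi s1 s2 (inv A0) (inv B));
          [exact HG | eapply ety_abs; eauto | | exact HT].
        eapply rst_trans; [|exact E]. now apply dconv_El, Hconv_dconv, Hconv_Prod.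
      * cbn. apply dctxconv_Con.
        repeat (apply Forall2_cons || apply Forall2_nil);
          assumption || now apply Hconv_Lam.
    + rename N2 into A0, N1 into B0, N0 into M, HN3 into HA0, HN2 into HB0,
        HN1 into HM, HN0 into HN'.
      destruct (HU A0 s1) as (IA & TA & CA); auto; [lia|..].
      { exact (@beta_normal_con _ _ [] [B0; M; N] _ HN). }
      destruct (HB A0 B0 s1 s2) as (T1 & B & -> & IB & TB & CB & E1); auto; [lia|..].
      { exact (@beta_normal_con _ _ [A0] [M; N] _ HN). }
      edestruct (IH G D (EPi s1 s2 (inv A0) (inv B)) M) as (IM & TM & CM);
        [lia | exact HD | | exact HM | |].
      { exact (@beta_normal_con _ _ [A0; DLam T1 B] [N] _ HN). }
      (* The function is read back first against the product built from the read-backs of its domain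
         and family. *)
      { left. exists s3. split; [eapply ety_prod; eauto|].
        now apply rst_sym, dconv_El, Hconv_dconv, Hconv_Prod. }
      edestruct (IH G D (inv A0) N) as (IN & TN & CN);
        [lia | exact HD | | exact HN' | |].
      { exact (@beta_normal_con _ _ [A0; DLam T1 B; M] [] _ HN). }
      { left. exists s1. split; auto. now apply rst_sym, dconv_El, Hconv_dconv. }
      split; [now constructor|]. split.
      * eapply ety_target_El with (B := esubst1 (inv N) (inv B)) (s := s2);
          [exact HG | eapply ety_app; eauto | | exact HT].
        eapply rst_trans; [|exact E]. apply dconv_El. rewrite tr_esubst1.
        (* The translated substitution instance is beta-expanded to match the type [El (B N)]
           assigned by the signature. *)
        apply rst_trans with (DApp (DLam T1 (tr (inv B))) (tr (inv N))).
        -- apply rst_sym, rst_step, dcc_root. left. constructor.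
        -- apply dctxconv_App; [|now apply Hconv_dconv].
           apply dctxconv_Lam; [apply rst_refl | now apply Hconv_dconv].
      * cbn. apply dctxconv_Con.
        repeat (apply Forall2_cons || apply Forall2_nil);
          assumption || now apply Hconv_Lam.
  (* Sorts, products and abstractions have types whose head is a sort or a product, never a base
     type. *)
  - apply dty_generation in HM. pose proof (target_head HT HM) as H.
    discriminate H; discriminate.
  - apply dty_generation in HM as (s & HM). pose proof (target_head HT HM) as H.
    discriminate H; discriminate.
  - apply dty_generation in HM as (B & _ & HM). pose proof (target_head HT HM) as H.
    discriminate H; discriminate.
  - now apply (beta_normal_no_App HD HN) in HM.
Qed.

Theorem mainTheorem16 (P : pts_spec) (hP : functional P)
    (G : ectx (sort P)) (D : dctx (econst (sort P))) (A : eterm (sort P))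
    (M T : dterm (econst (sort P)))
    (hA : etype G A)
    (hD : trctx G D)
    (hM : beta_normal M)
    (hT : (exists sA, ety G A (ESort sA) /\ T = DEl sA (tr A)) \/
          (exists s, A = ESort s /\ T = DU s))
    (hMT : dty (EPTS P) D M T) :
  invertible M /\ ety G (inv M) A /\ Hconv (tr (inv M)) M.
Proof.
  eapply conservativity_up_to_conversion;
    eauto using le_n, trctx_ctxrel.
  destruct hT as [(s & ? & ->)|(s & -> & ->)];
    [left | right]; exists s; split; auto; apply rst_refl.
Qed.
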